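(* The unimodular simply connected Lie group $S_{13}^0$ has lattices.
   Context: A lattice in a simply connected solvable Lie group $G$ is a discrete subgroup $\Gamma$ with $\Gamma\backslash G$ compact. $S_{13}^0$ is the simply connected Lie group $\mathbb{R}\times\mathbb{R}^{11}$ with product $(t,v)(s,w)=(t+s,v+e^{tA}w)$, where $$A=0_3\oplus\begin{bmatrix}K&0\\ I_4&K\end{bmatrix},\qquad K=\begin{bmatrix}0&-1&0&0\\ 1&0&0&0\\ 0&0&0&1\\ 0&0&-1&0\end{bmatrix},$$ and $\oplus$ denotes block diagonal sum. *)

(* Defs.v *)
From HB Require Import structures.
From mathcomp Require Import all_boot all_order all_algebra.
From mathcomp Require Import generic_quotient.
From mathcomp Require Import all_classical all_reals all_analysis.
From mathcomp Require Import ring lra.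

Set Implicit Arguments.
Unset Strict Implicit.
Unset Printing Implicit Defensive.

Import Order.TTheory GRing.Theory Num.Theory.
Import numFieldNormedType.Exports.

Local Open Scope classical_set_scope.
Local Open Scope ring_scope.
Local Open Scope quotient_scope.

HB.mixin Record isTopologicalGroup G & Topological G & Group G := {
  mulg_continuous : continuous (fun x : G * G => (x.1 * x.2)%g) ;
  invg_continuous : continuous (fun x : G => (x^-1)%g)
}.

#[short(type="topologicalGroupType")]
HB.structure Definition TopologicalGroup :=
  {G of Topological G & Group G & isTopologicalGroup G}.

Section Lattice.
Variables (G : topologicalGroupType) (Gam : set G).

Definition right_coset (g : G) : set G := [set (c * g)%g | c in Gam].

(* When Gam is a subgroup, this is x * y^-1 \in Gam. *)
Definition same_right_coset : rel G := [rel x y | `[< right_coset x = right_coset y >]].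

Lemma same_right_coset_refl : reflexive same_right_coset.
Proof. by move=> x; apply/asboolP. Qed.

Lemma same_right_coset_sym : symmetric same_right_coset.
Proof. by move=> x y; apply: asbool_equiv_eq; split=> ->. Qed.

Lemma same_right_coset_trans : transitive same_right_coset.
Proof. by move=> y x z /asboolP xy /asboolP yz; apply/asboolP; rewrite xy. Qed.

Definition right_coset_equiv :=
  EquivRel same_right_coset same_right_coset_refl same_right_coset_sym same_right_coset_trans.

Definition right_coset_space : topologicalType :=
  quotient_topology {eq_quot right_coset_equiv}.

Definition is_lattice : Prop :=
  [/\ group_closed [in Gam], Gam `<=` isolated Gam
    & compact [set: right_coset_space]].

End Lattice.

Definition expmx (R : realType) (n : nat) (M : 'M[R]_n.+1) : 'M[R]_n.+1 :=
  lim (series (fun k => (k`!%:R)^-1 *: M ^+ k) @ \oo).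

Section Group.
Variable R : realType.

Definition Kmx : 'M[R]_4 := \matrix_(i, j)
  nth 0 (nth [::] [:: [:: 0; -1; 0;  0];
                      [:: 1;  0; 0;  0];
                      [:: 0;  0; 0;  1];
                      [:: 0;  0; -1; 0]] i) j.

Definition Amx : 'M[R]_11 :=
  block_mx (0 : 'M[R]_3) 0 0 (block_mx Kmx 0 1%:M Kmx).

Definition S130 : Type := (R * 'cV[R]_11)%type.
HB.instance Definition _ := Topological.copy S130 (R * 'cV[R]_11)%type.

Definition S130_mul (x y : S130) : S130 :=
  (x.1 + y.1, x.2 + expmx (x.1 *: Amx) *m y.2).
Definition S130_one : S130 := (0, 0).
Definition S130_inv (x : S130) : S130 :=
  (- x.1, - (expmx ((- x.1) *: Amx) *m x.2)).

(* Closed form of e^{tA} (lemma expmx_AmxE), used to check the group axioms. *)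
Definition blk8 (M : 'M[R]_(4 + 4)) : 'M[R]_11 := block_mx (0 : 'M[R]_3) 0 0 M.
Definition Z3 : 'M[R]_11 := block_mx (1%:M : 'M[R]_3) 0 0 (0 : 'M[R]_(4 + 4)).
Definition I8 := blk8 (block_mx 1%:M 0 0 1%:M).
Definition J8 := blk8 (block_mx Kmx 0 0 Kmx).
Definition N8 := blk8 (block_mx 0 0 1%:M 0).
Definition JN8 := blk8 (block_mx 0 0 Kmx 0).
Definition expA (t : R) := Z3 + cos t *: I8 + sin t *: J8
                  + (t * cos t) *: N8 + (t * sin t) *: JN8.

Lemma Kmx2 : Kmx *m Kmx = - 1%:M.
Proof.
apply/matrixP => i j; rewrite !mxE !big_ord_recl big_ord0 !mxE /=.
by case: i => [[|[|[|[|//]]]] ?]; case: j => [[|[|[|[|//]]]] ?]; rewrite /= /bump /=; ring.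
Qed.

Lemma blk8M X Y : blk8 X * blk8 Y = blk8 (X *m Y).
Proof.
have := mulmx_block (0 : 'M[R]_3) (0 : 'M[R]_(3, 4 + 4)) 0 X (0 : 'M[R]_3) 0 0 Y.
by rewrite !(mul0mx, mulmx0, addr0, add0r).
Qed.

Lemma blk8D X Y : blk8 X + blk8 Y = blk8 (X + Y).
Proof.
have := add_block_mx (0 : 'M[R]_3) (0 : 'M[R]_(3, 4 + 4)) 0 X (0 : 'M[R]_3) 0 0 Y.
by rewrite !addr0.
Qed.

Lemma blk8N X : - blk8 X = blk8 (- X).
Proof.
have := opp_block_mx (0 : 'M[R]_3) (0 : 'M[R]_(3, 4 + 4)) 0 X.
by rewrite !oppr0.
Qed.

Ltac blk := rewrite ?blk8N ?blk8M ?blk8D; congr (blk8 _);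
  rewrite ?opp_block_mx ?mulmx_block ?add_block_mx;
  rewrite !(mul0mx, mulmx0, mul1mx, mulmx1, Kmx2, addr0, add0r, oppr0).

Lemma Amx_Z3 : Amx * Z3 = 0.
Proof.
have := mulmx_block (0 : 'M[R]_3) (0 : 'M[R]_(3, 4 + 4)) 0
  (block_mx Kmx 0 1%:M Kmx) (1%:M : 'M[R]_3) 0 0 (0 : 'M[R]_(4 + 4)).
rewrite !(mul0mx, mulmx0, addr0, add0r) => h.
rewrite block_mx0 in h; exact: h.
Qed.

Lemma Amx_I8 : Amx * I8 = J8 + N8.
Proof. by blk. Qed.

Lemma Amx_J8 : Amx * J8 = - I8 + JN8.
Proof. by blk. Qed.

Lemma Amx_N8 : Amx * N8 = JN8.
Proof. by blk. Qed.

Lemma Amx_JN8 : Amx * JN8 = - N8.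
Proof. by blk. Qed.

Definition cosK (k : nat) : R := (~~ odd k)%:R * (-1) ^+ k./2.
Definition sinK (k : nat) : R := (odd k)%:R * (-1) ^+ k.-1./2.

Lemma cosKS k : cosK k.+1 = - sinK k.
Proof.
case: k => [|k]; rewrite /cosK /sinK /= ?negbK; first by rewrite !mul0r oppr0.
by rewrite exprS; ring.
Qed.

Lemma sinKS k : sinK k.+1 = cosK k.
Proof. by []. Qed.

Lemma Z3I8 : Z3 + I8 = 1.
Proof.
have := add_block_mx (1%:M : 'M[R]_3) (0 : 'M[R]_(3, 4 + 4)) 0 0
  (0 : 'M[R]_3) 0 0 (block_mx 1%:M 0 0 1%:M).
by rewrite !addr0 !add0r -!scalar_mx_block => h; rewrite /I8 -scalar_mx_block.
Qed.

Lemma Amx_lin (a b c d e : R) :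
  Amx * (a *: Z3 + b *: I8 + c *: J8 + d *: N8 + e *: JN8) =
  0 *: Z3 + (- c) *: I8 + b *: J8 + (b - e) *: N8 + (c + d) *: JN8.
Proof.
rewrite 4!mulrDr -5!scalerAr Amx_Z3 Amx_I8 Amx_J8 Amx_N8 Amx_JN8.
apply/matrixP => i j; rewrite !mxE; ring.
Qed.

Lemma Amx_exp k : Amx ^+ k = (k == 0)%:R *: Z3 + cosK k *: I8 + sinK k *: J8
  + (k%:R * cosK k.-1) *: N8 + (k%:R * sinK k.-1) *: JN8.
Proof.
elim: k => [|k IH].
  rewrite expr0 /cosK /sinK /= !mul0r !scale0r !mul1r !scale1r !addr0.
  by rewrite Z3I8.
rewrite exprS IH Amx_lin cosKS sinKS /=.
congr (_ + _ + _ + _ + _); congr (_ *: _).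
- by case: k {IH} => [|k]; rewrite ?cosKS /=; ring.
- by case: k {IH} => [|k]; rewrite ?sinKS /=; [rewrite /sinK /=|]; ring.
Qed.

Definition shift_coeff (f : nat -> R) (t : R) (k : nat) : R :=
  (k`!%:R)^-1 * t ^+ k * (k%:R * f k.-1).

Lemma shift_coeffS f t k : shift_coeff f t k.+1 = t * (f k * t ^+ k / k`!%:R).
Proof.
rewrite /shift_coeff factS natrM exprS invfM /=.
have : k.+1%:R != 0 :> R by rewrite pnatr_eq0.
have : k`!%:R != 0 :> R by rewrite pnatr_eq0 -lt0n fact_gt0.
by move=> *; field; apply/andP.
Qed.

Lemma cvg_shift_coeff f t l :
  series (fun k => f k * t ^+ k / k`!%:R) @ \oo --> l ->
  series (shift_coeff f t) @ \oo --> t * l.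
Proof.
move=> h; rewrite -cvg_shiftS.
have -> : [sequence series (shift_coeff f t) n.+1]_n =
    (fun n => t * series (fun k => f k * t ^+ k / k`!%:R) n).
  apply/funext => n; rewrite /series /= big_nat_recl // {1}/shift_coeff mul0r mulr0 add0r.
  by rewrite mulr_sumr; apply: eq_bigr => i _; rewrite shift_coeffS.
exact: cvgMl_tmp h.
Qed.

Lemma cvg_scale_series (f : nat -> R) (l : R) (M : 'M[R]_11) :
  series f @ \oo --> l -> series (fun k => f k *: M) @ \oo --> l *: M.
Proof.
move=> h; have -> : series (fun k => f k *: M) = (fun n => series f n *: M).
  by apply/funext => n; rewrite /series /= scaler_suml.
exact: cvgZr_tmp.
Qed.

Lemma expmx_AmxE t : expmx (t *: Amx) = expA t.
Proof.
apply: cvg_lim => //.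
have -> : (fun k => (k`!%:R)^-1 *: (t *: Amx) ^+ k) =
   (fun k => (k == 0)%:R *: Z3) + (fun k => cos_coeff t k *: I8)
   + (fun k => sin_coeff t k *: J8) + (fun k => shift_coeff cosK t k *: N8)
   + (fun k => shift_coeff sinK t k *: JN8).
  apply/funext => k; rewrite exprZn Amx_exp !fctE !scalerDr !scalerA.
  congr (_ + _ + _ + _ + _); congr (_ *: _).
  - by case: k => [|k]; rewrite /= ?mulr0// fact0 invr1 expr0 !mulr1.
  - by rewrite -[RHS]/(cosK k * t ^+ k / k`!%:R); ring.
  - by rewrite -[RHS]/(sinK k * t ^+ k / k`!%:R); ring.
rewrite !seriesD.
have dZ : series (fun k => (k == 0)%:R : R) @ \oo --> (1 : R).
  rewrite -cvg_shiftS; apply: cvg_near_cst; apply: nearW => n.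
  by rewrite /series /= big_nat_recl // big1 ?addr0.
have cC : series (cos_coeff t) @ \oo --> cos t.
  by rewrite unlock; exact: is_cvg_series_cos_coeff.
have cS : series (sin_coeff t) @ \oo --> sin t.
  by rewrite unlock; exact: is_cvg_series_sin_coeff.
have -> : expA t = 1 *: Z3 + cos t *: I8 + sin t *: J8
                  + (t * cos t) *: N8 + (t * sin t) *: JN8.
  by rewrite scale1r.
apply: cvgD; last by apply: cvg_scale_series; exact: cvg_shift_coeff.
apply: cvgD; last by apply: cvg_scale_series; exact: cvg_shift_coeff.
by apply: cvgD; [apply: cvgD|]; apply: cvg_scale_series.
Qed.

Lemma Z3_mul : [/\ Z3 * Z3 = Z3, Z3 * I8 = 0, Z3 * J8 = 0, Z3 * N8 = 0
  & Z3 * JN8 = 0].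
Proof.
have ZB (X : 'M[R]_(4 + 4)) : Z3 * blk8 X = 0.
  have := mulmx_block (1%:M : 'M[R]_3) (0 : 'M[R]_(3, 4 + 4)) 0
     (0 : 'M[R]_(4 + 4)) (0 : 'M[R]_3) 0 (0 : 'M[R]_(4 + 4, 3)) X.
  by rewrite !(mul0mx, mulmx0, addr0, add0r) block_mx0.
split; rewrite ?ZB //.
have := mulmx_block (1%:M : 'M[R]_3) (0 : 'M[R]_(3, 4 + 4)) 0
     (0 : 'M[R]_(4 + 4)) (1%:M : 'M[R]_3) 0 (0 : 'M[R]_(4 + 4, 3))
     (0 : 'M[R]_(4 + 4)).
by rewrite !(mul0mx, mulmx0, mul1mx, addr0, add0r).
Qed.

Lemma blk8_Z3 (X : 'M[R]_(4 + 4)) : blk8 X * Z3 = 0.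
Proof.
have := mulmx_block (0 : 'M[R]_3) (0 : 'M[R]_(3, 4 + 4)) 0 X
  (1%:M : 'M[R]_3) 0 (0 : 'M[R]_(4 + 4, 3)) (0 : 'M[R]_(4 + 4)).
by rewrite !(mul0mx, mulmx0, addr0, add0r) block_mx0.
Qed.

Lemma expA0 : expA 0 = 1.
Proof.
by rewrite /expA cos0 sin0 !mul0r !scale0r scale1r !addr0 Z3I8.
Qed.

Lemma expAD s t : expA (s + t) = expA s * expA t.
Proof.
have [ZZ ZI ZJ ZN ZK] := Z3_mul.
have II : I8 * I8 = I8 by blk.
have IJ : I8 * J8 = J8 by blk.
have IN : I8 * N8 = N8 by blk.
have IK : I8 * JN8 = JN8 by blk.
have JI : J8 * I8 = J8 by blk.
have JJ : J8 * J8 = - I8 by blk.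
have JN : J8 * N8 = JN8 by blk.
have JK : J8 * JN8 = - N8 by blk.
have NI : N8 * I8 = N8 by blk.
have NJ : N8 * J8 = JN8 by blk.
have NN : N8 * N8 = 0 by rewrite blk8M mulmx_block !(mul0mx, mulmx0, addr0) /blk8 !block_mx0.
have NK : N8 * JN8 = 0 by rewrite blk8M mulmx_block !(mul0mx, mulmx0, addr0) /blk8 !block_mx0.
have KI : JN8 * I8 = JN8 by blk.
have KJ : JN8 * J8 = - N8 by blk.
have KN : JN8 * N8 = 0 by rewrite blk8M mulmx_block !(mul0mx, mulmx0, addr0) /blk8 !block_mx0.
have KK : JN8 * JN8 = 0 by rewrite blk8M mulmx_block !(mul0mx, mulmx0, addr0) /blk8 !block_mx0.
rewrite /expA !mulrDl !mulrDr -!scalerAl -!scalerAr.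
rewrite ZZ ZI ZJ ZN ZK !blk8_Z3 II IJ IN IK JI JJ JN JK NI NJ NN NK KI KJ KN KK.
rewrite cosD sinD.
by apply/matrixP => i j; rewrite !mxE; ring.
Qed.

Lemma S130_mulA : associative S130_mul.
Proof.
move=> [t u] [s v] [r w]; rewrite /S130_mul !expmx_AmxE /=.
by rewrite addrA expAD mulmxDr mulmxA addrA.
Qed.

Lemma S130_mul1 : left_id S130_one S130_mul.
Proof.
by move=> [t u]; rewrite /S130_mul expmx_AmxE /= !add0r expA0 mul1mx.
Qed.

Lemma S130_mulr1 : right_id S130_one S130_mul.
Proof. by move=> [t u]; rewrite /S130_mul /= mulmx0 !addr0. Qed.

Lemma S130_mulV : left_inverse S130_one S130_inv S130_mul.
Proof. by move=> [t u]; rewrite /S130_mul /= !addNr. Qed.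

Lemma S130_mulrV : right_inverse S130_one S130_inv S130_mul.
Proof.
move=> [t u]; rewrite /S130_mul /S130_inv !expmx_AmxE /=.
rewrite mulmxN mulmxA -[_ *m expA _]expAD !subrr expA0 mul1mx.
by rewrite subrr.
Qed.

HB.instance Definition _ := isGroup.Build S130
  S130_mulA S130_mul1 S130_mulr1 S130_mulV S130_mulrV.

Lemma mx_cvg (T : Type) (F : set_system T) (FF : Filter F) m n
    (f : T -> 'M[R]_(m, n)) (l : 'M[R]_(m, n)) :
  (forall i j, f x i j @[x --> F] --> l i j) -> f @ F --> l.
Proof.
move=> h A [P nP sPA].
have hP : \forall x \near F, forall i j, P i j (f x i j).
  apply: filter_forall => i; apply: filter_forall => j.
  exact: (h i j _ (nP i j)).
by apply: filterS hP => x Px; apply: sPA.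
Qed.

Lemma expA_continuous : continuous expA.
Proof.
move=> t; rewrite /expA.
have ct : cos x @[x --> t] --> cos t by exact: continuous_cos.
have st : sin x @[x --> t] --> sin t by exact: continuous_sin.
apply: cvgD; last by apply: cvgZr_tmp; apply: cvgM.
apply: cvgD; last by apply: cvgZr_tmp; apply: cvgM.
apply: cvgD; last exact: cvgZr_tmp.
by apply: cvgD; [exact: cvg_cst|exact: cvgZr_tmp].
Qed.

Lemma mulmx_cvg (T : Type) (F : set_system T) (FF : Filter F) m n p
    (f : T -> 'M[R]_(m, n)) (g : T -> 'M[R]_(n, p))
    (a : 'M[R]_(m, n)) (b : 'M[R]_(n, p)) :
  f @ F --> a -> g @ F --> b -> (f x *m g x) @[x --> F] --> a *m b.
Proof.
move=> fa gb; apply: mx_cvg => i j; rewrite mxE.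
under eq_fun do rewrite mxE.
apply: cvg_big => [|k _]; [exact: add_continuous|apply: cvgM].
- exact: (cvg_comp _ _ fa (@coord_continuous _ _ _ i k a)).
- exact: (cvg_comp _ _ gb (@coord_continuous _ _ _ k j b)).
Qed.

Lemma cvg_fst_at (U V : topologicalType) (p : U * V) :
  x.1 @[x --> p] --> p.1.
Proof. by case: p => a b; exact: cvg_fst. Qed.

Lemma cvg_snd_at (U V : topologicalType) (p : U * V) :
  x.2 @[x --> p] --> p.2.
Proof. by case: p => a b; exact: cvg_snd. Qed.

Lemma cvg_S130 (T : Type) (F : set_system T) (FF : Filter F)
    (f : T -> R) (g : T -> 'cV[R]_11) (a : R) (b : 'cV[R]_11) :
  f @ F --> a -> g @ F --> b -> (f x, g x) @[x --> F] --> ((a, b) : S130).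
Proof. by move=> fa gb; exact: (@cvg_pair _ _ _ F (nbhs a) (nbhs b) _ _ _ f g fa gb). Qed.

Lemma S130_mul_continuous : continuous (fun x : S130 * S130 => (x.1 * x.2)%g).
Proof.
move=> [[t u] [s v]].
have -> : (fun x : S130 * S130 => (x.1 * x.2)%g) =
  (fun x => (x.1.1 + x.2.1, x.1.2 + expA x.1.1 *m x.2.2)).
  by apply/funext => x; rewrite -[LHS]/(S130_mul _ _) /S130_mul expmx_AmxE.
pose p : S130 * S130 := ((t, u), (s, v)).
have c1 := @cvg_fst_at _ _ p; have c2 := @cvg_snd_at _ _ p.
have c11 := cvg_comp _ _ c1 (@cvg_fst_at _ _ p.1).
have c12 := cvg_comp _ _ c1 (@cvg_snd_at _ _ p.1).
have c21 := cvg_comp _ _ c2 (@cvg_fst_at _ _ p.2).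
have c22 := cvg_comp _ _ c2 (@cvg_snd_at _ _ p.2).
apply: cvg_S130; first exact: cvgD.
apply: cvgD => //; apply: mulmx_cvg => //.
exact: (cvg_comp _ _ c11 (@expA_continuous t)).
Qed.

Lemma S130_inv_continuous : continuous (fun x : S130 => (x^-1)%g).
Proof.
move=> [t u].
have -> : (fun x : S130 => (x^-1)%g) = (fun x => (- x.1, - (expA (- x.1) *m x.2))).
  by apply/funext => x; rewrite -[LHS]/(S130_inv _) /S130_inv expmx_AmxE.
have c1 := @cvg_fst_at _ _ (t, u); have c2 := @cvg_snd_at _ _ (t, u).
apply: cvg_S130; first exact: cvgN.
apply: cvgN; apply: mulmx_cvg => //.
exact: (cvg_comp _ _ (cvgN c1) (@expA_continuous (- t))).
Qed.

HB.instance Definition _ := isTopologicalGroup.Build S130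
  S130_mul_continuous S130_inv_continuous.

(* Global chart R^12 -> S130, its inverse, and Ad(g) as the Jacobian at the
   identity of conjugation by g. A connected Lie group is unimodular iff
   |det Ad(g)| = 1 for all g: this is the modular function (or its inverse). *)
Definition S130_chart (u : 'rV[R]_(1 + 11)) : S130 :=
  (lsubmx u 0 0, (rsubmx u)^T).

Definition S130_coord (x : S130) : 'rV[R]_(1 + 11) :=
  row_mx (x.1)%:M (x.2)^T.

Definition S130_Ad (g : S130) : 'M[R]_(1 + 11) :=
  'J (fun u => S130_coord (g * S130_chart u * g^-1)%g) (S130_coord 1%g).

Definition S130_unimodular : Prop := forall g : S130, `|\det (S130_Ad g)| = 1.

End Group.

(* Main.v *)
(* On the subspace R^8 with block matrix [K 0; I K], one has
   e^{tA} = [R 0; tR R] with R = cos t + (sin t) K orthogonal, so e^{tA} has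
   determinant 1; Ad(t, v) is block triangular with diagonal blocks 1 and
   e^{tA}, whence unimodularity. At t = 2 pi m, e^{tA} is the shear
   1 + 2 pi m N, where N maps the first R^4 identically onto the second.
   Conjugating by D = diag(1_3, 1_4, 2 pi 1_4) turns it into the integer matrix
   1 + m N, so that the (2 pi m, D z) with m and z integral form a subgroup;
   it is discrete, and [0, 2 pi] x D [0, 1]^11 meets all of its cosets. *)
From HB Require Import structures.
Require Import Defs.
From mathcomp Require Import all_boot all_order all_algebra.
From mathcomp Require Import all_classical all_reals all_analysis.
From mathcomp Require Import ring.

Set Implicit Arguments.
Unset Strict Implicit.
Unset Printing Implicit Defensive.

Import Order.TTheory GRing.Theory Num.Theory.
Import numFieldNormedType.Exports.

Local Open Scope classical_set_scope.
Local Open Scope ring_scope.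

(** * Integer multiples of a period, integral matrices and cosets *)

Lemma periodicz (U V : zmodType) (f : U -> V) (T : U) :
  periodic f T -> forall (m : int) a, f (a + T *~ m) = f a.
Proof.
move=> fT [n|n] a; first exact: periodicn.
(* [Negz n] is [-(n+1)], so [a] is seen as the shift of [a - (n+1)T] by [n+1] periods. *)
by rewrite NegzE mulrNz -[in RHS](subrK (T *+ n.+1) a) [RHS](periodicn fT).
Qed.

Lemma mxOverD (V : nmodType) (S : addrClosed V) (m n : nat)
    (A B : 'M[V]_(m, n)) :
  A \is a mxOver S -> B \is a mxOver S -> A + B \is a mxOver S.
Proof.
by move=> /mxOverP hA /mxOverP hB; apply/mxOverP => i j; rewrite mxE rpredD.
Qed.

Lemma mxOverB (V : zmodType) (S : zmodClosed V) (m n : nat)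
    (A B : 'M[V]_(m, n)) :
  A \is a mxOver S -> B \is a mxOver S -> A - B \is a mxOver S.
Proof.
by move=> /mxOverP hA /mxOverP hB; apply/mxOverP => i j; rewrite !mxE rpredB.
Qed.

Lemma right_coset_mull (G : topologicalGroupType) (H : set G) (c g : G) :
  group_closed [in H] -> H c -> right_coset H (c * g)%g = right_coset H g.
Proof.
move=> gH Hc; have [_ hM] := gH; rewrite /right_coset.
apply/seteqP; split=> _ [d Hd <-].
  exists (d * c)%g; last by rewrite mulgA.
  by have := group_closedM gH; move=> /(_ d c); rewrite !inE; apply.
exists (d / c)%g; last by rewrite mulgA -(mulgA d) mulVg mulg1.
by have := hM d c; rewrite !inE; apply.
Qed.

(** * Unimodularity: the Jacobian of conjugation at the identity *)

Section Unimodular.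
Variable R : realType.
Implicit Types t : R.

Definition rotK t : 'M[R]_4 := cos t *: 1%:M + sin t *: Kmx R.

Lemma trmx_Kmx : (Kmx R)^T = - Kmx R.
Proof.
apply/matrixP => i j; rewrite !mxE.
by case: i => [[|[|[|[|//]]]] ?]; case: j => [[|[|[|[|//]]]] ?];
  rewrite /= ?opprK ?oppr0.
Qed.

(** Since [K^T = -K] and [K^2 = -1], the product of [rotK t] with its transpose is
    [cos^2 t + sin^2 t = 1]. The square is enough because [rotK t] occurs twice on the diagonal of
    [expA t]. *)
Lemma det_rotK_sqr t : \det (rotK t) ^+ 2 = 1.
Proof.
rewrite expr2 -{2}det_tr -det_mulmx /rotK linearD !linearZ /= trmx1 trmx_Kmx.
rewrite mulmxDl !mulmxDr -!scalemxAl -!scalemxAr !mul1mx !mulmx1 mulmxN Kmx2.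
rewrite opprK.
suff -> : cos t *: (cos t *: 1%:M) + cos t *: (sin t *: - Kmx R) +
  (sin t *: (cos t *: Kmx R) + sin t *: (sin t *: 1%:M)) =
  (cos t ^+ 2 + sin t ^+ 2) *: 1%:M.
  by rewrite cos2Dsin2 scale1r det1.
by move: (Kmx R) => K; apply/matrixP => i j; rewrite !mxE; ring.
Qed.

Lemma expA_block t :
  expA t = block_mx (1%:M : 'M[R]_3) 0 0
             (block_mx (rotK t) 0 (t *: rotK t) (rotK t)).
Proof.
have sc a (X : 'M[R]_(4 + 4)) : a *: blk8 X = blk8 (a *: X).
  have := scale_block_mx a (0 : 'M[R]_3) (0 : 'M[R]_(3, 4 + 4)) 0 X.
  by rewrite !scaler0.
have ZD (X : 'M[R]_(4 + 4)) : Z3 R + blk8 X = block_mx (1%:M : 'M[R]_3) 0 0 X.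
  have := add_block_mx (1%:M : 'M[R]_3) (0 : 'M[R]_(3, 4 + 4)) 0 0
    (0 : 'M[R]_3) 0 0 X.
  by rewrite !addr0 !add0r.
rewrite /expA /I8 /J8 /N8 /JN8 !sc -!addrA !blk8D ZD /rotK.
rewrite !scale_block_mx !add_block_mx !(scaler0, addr0, add0r).
by rewrite scalerDr !scalerA.
Qed.

Lemma det_expA t : \det (expA t) = 1.
Proof.
(* The size 11 is restated as [3 + (4 + 4)], so that the block determinant formulas apply. *)
rewrite expA_block; rewrite -[LHS]/(\det (block_mx (1%:M : 'M[R]_3) 0 0
             (block_mx (rotK t) 0 (t *: rotK t) (rotK t)))).
by rewrite det_ublock det_lblock det1 mul1r -expr2 det_rotK_sqr.
Qed.

(** With [g = (t, v)], the identity [e^{(t+s)A} e^{-tA} = e^{sA}] separates conjugation into a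
    linear map of [u] and a term depending only on its first coordinate [s]. The latter is the only
    nonlinear part left to differentiate. *)
Lemma S130_conj_coord (g : S130 R) (u : 'rV[R]_(1 + 11)) :
  S130_coord (g * S130_chart u * g^-1)%g =
  u *m block_mx 1%:M 0 0 (expA g.1)^T
    + row_mx 0 (g.2 - expA (lsubmx u 0 0) *m g.2)^T.
Proof.
have -> : (g * S130_chart u * g^-1)%g =
  S130_mul (S130_mul g (S130_chart u)) (S130_inv g) by [].
case: g => t v; rewrite /S130_coord /S130_mul /S130_inv /S130_chart /=.
have -> : u *m block_mx 1%:M 0 0 (expA t)^T =
    row_mx (lsubmx u) (rsubmx u *m (expA t)^T).
  rewrite -{1}[u]hsubmxK.
  have := mul_row_block (lsubmx u) (rsubmx u) 1%:M 0 0 (expA t)^T.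
  by rewrite !(mulmx0, addr0, add0r) mulmx1.
rewrite !expmx_AmxE add_row_mx addr0; congr row_mx.
  by rewrite addrAC subrr add0r [RHS]mx11_scalar.
have -> : expA (t + lsubmx u 0 0) *m - (expA (- t) *m v) =
    - (expA (lsubmx u 0 0) *m v).
  rewrite mulmxN mulmxA; congr (- (_ *m v)).
  by rewrite -[LHS]/(expA _ * expA _) -expAD addrAC subrr add0r.
have -> : rsubmx u *m (expA t)^T = (expA t *m (rsubmx u)^T)^T.
  by rewrite trmx_mul trmxK.
move: (expA t *m _) (expA _ *m v) => W X.
by rewrite -linearD /= addrCA addrA.
Qed.

Lemma is_diff_scaler_cst (V W : normedModType R) (k dk : V -> R) (a : W)
    (x : V) :
  is_diff x k dk -> is_diff x (fun z => k z *: a) (fun h => dk h *: a).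
Proof.
move=> dkx; apply: DiffDef; first exact: differentiableZl.
by rewrite diffZl // diff_val.
Qed.

Lemma is_derive_is_diff (f : R -> R) (x l : R) :
  is_derive x 1 f l -> is_diff x f (fun h => h * l).
Proof.
move=> [fx <-]; apply: DiffDef; first exact/derivable1_diffP.
by rewrite (deriv1E fx) derive1E.
Qed.

Lemma is_diff_linear (V W : normedModType R) (f : {linear V -> W}) (x : V) :
  continuous f -> is_diff x f f.
Proof.
by move=> fc; apply: DiffDef; [exact: linear_differentiable|exact: diff_lin].
Qed.

(** The domain has finite dimension: [f] is a finite sum of coordinate functions times fixed
    vectors. *)
Lemma linear_mx_continuous (m n : nat) (V : normedModType R)
    (f : {linear 'M[R]_(m, n) -> V}) : continuous f.
Proof.
have -> : (f : 'M[R]_(m, n) -> V) =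
    (fun M => \sum_i \sum_j M i j *: f (delta_mx i j)).
  apply/funext => M; rewrite {1}[M]matrix_sum_delta !linear_sum.
  apply: eq_bigr => i _; rewrite linear_sum.
  by apply: eq_bigr => j _; rewrite linearZ.
move=> M; have FF : Filter (nbhs M) by exact: nbhs_filter.
apply: cvg_big => [|i _]; first exact: add_continuous.
apply: cvg_big => [|j _]; first exact: add_continuous.
apply: cvgZr_tmp; exact: coord_continuous.
Qed.

Lemma is_diff_expA t : is_diff t (@expA R) (fun h => h *: (Amx R * expA t)).
Proof.
have ct : is_diff t cos (fun h => h * (- sin t)) by exact: is_derive_is_diff.
have st : is_diff t sin (fun h => h * cos t) by exact: is_derive_is_diff.
have it : is_diff t (id : R -> R) id by exact: is_diff_id.
have d := is_diffD (is_diffD (is_diffD (is_diffD (is_diff_cst (Z3 R) t)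
  (is_diff_scaler_cst (I8 R) ct)) (is_diff_scaler_cst (J8 R) st))
  (is_diff_scaler_cst (N8 R) (is_diffM it ct)))
  (is_diff_scaler_cst (JN8 R) (is_diffM it st)).
apply: is_diff_eq d _.
(* Giving [Z3] the coefficient 1 puts [expA t] in the form where [Amx_lin] computes [A e^{tA}], to
   be compared with the termwise derivative. *)
apply/funext => h; rewrite /expA -[Z3 R]scale1r Amx_lin /=.
rewrite !fctE.
move: (Z3 R) (I8 R) (J8 R) (N8 R) (JN8 R) => *.
by apply/matrixP => i j; rewrite !mxE /GRing.scale /=; ring.
Qed.

(** The identity has first coordinate [s = 0], where the derivative of [v - e^{sA} v] is [-A v];
    this gives the off-diagonal block. The transposes come from acting on row vectors. *)
Lemma S130_conj_diff (g : S130 R) :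
  is_diff (S130_coord 1%g : 'rV[R]_(1 + 11))
    (fun u => S130_coord (g * S130_chart u * g^-1)%g)
    (mulmxr (block_mx 1%:M (- (Amx R *m g.2)^T) 0 (expA g.1)^T)).
Proof.
pose v := g.2.
pose l (M : 'M[R]_11) : 'rV[R]_(1 + 11) := row_mx 0 (M *m v)^T.
have l_lin : linear l.
  move=> a M N; rewrite /l mulmxDl -scalemxAl linearD linearZ /=.
  rewrite -[X in row_mx X _](addr0 0) -{1}(scaler0 _ a).
  by rewrite -add_row_mx -scale_row_mx.
pose lM := GRing.isLinear.Build _ _ _ _ _ l_lin.
pose L : {linear 'M[R]_11 -> 'rV[R]_(1 + 11)} := HB.pack l lM.
have L_cont : continuous L by exact: linear_mx_continuous.
pose P : 'M[R]_(1 + 11) := block_mx 1%:M 0 0 (expA g.1)^T.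
have P_cont : continuous (mulmxr P : 'rV[R]_(1 + 11) -> 'rV[R]_(1 + 11)).
  exact: linear_mx_continuous.
have s_lin : linear (fun u : 'rV[R]_(1 + 11) => lsubmx u 0 0 : R).
  by move=> a x y; rewrite !mxE.
pose sM := GRing.isLinear.Build _ _ _ _ _ s_lin.
pose S : {linear 'rV[R]_(1 + 11) -> R} :=
  HB.pack (fun u : 'rV[R]_(1 + 11) => lsubmx u 0 0 : R) sM.
have s_diff p : is_diff p (fun u : 'rV[R]_(1 + 11) => lsubmx u 0 0)
    (fun u => lsubmx u 0 0).
  exact: (is_diff_linear p (linear_mx_continuous (f := S))).
set p := S130_coord _.
have p0 : lsubmx p 0 0 = 0 by rewrite /p /S130_coord row_mxKl mxE.
have dE := is_diff_comp (s_diff p) (is_diff_expA (lsubmx p 0 0)).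
have dL := is_diff_comp dE (is_diff_linear (expA (lsubmx p 0 0)) L_cont).
have d := is_diffB
  (is_diffD (is_diff_linear p P_cont) (is_diff_cst (L 1) p)) dL.
(* Here [v - e^{sA} v] becomes [L 1 - L (e^{sA})], so the chain rule uses only the linear [L] and
   [is_diff_expA]. *)
have -> : (fun u => S130_coord (g * S130_chart u * g^-1)%g) =
   (mulmxr P : 'rV[R]_(1 + 11) -> 'rV[R]_(1 + 11)) \+ cst (L 1)
     \- (L \o (@expA R \o fun u => lsubmx u 0 0)).
  apply/funext => u; rewrite S130_conj_coord -[RHS]addrA; congr (_ + _).
  rewrite -[RHS]/(L 1 - L (expA (lsubmx u 0 0))) -linearB /=.
  by rewrite /l mulmxBl mul1mx.
apply: is_diff_eq d _; apply/funext => h /=.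
rewrite p0 expA0 mulr1 !fctE /= addr0 /l -/v.
rewrite -[h]hsubmxK !mul_row_block row_mxKl.
rewrite !mulmx0 mulmx1 !addr0 add0r opp_row_mx oppr0 add_row_mx addr0.
congr row_mx; rewrite {2}[lsubmx h]mx11_scalar mul_scalar_mx scalerN addrC.
by rewrite -scalemxAl linearZ.
Qed.

Lemma S130_is_unimodular : S130_unimodular R.
Proof.
move=> g; rewrite /S130_Ad; have db := S130_conj_diff g.
suff -> : 'J (fun u => S130_coord (g * S130_chart u * g^-1)%g)
    (S130_coord 1%g) =
   block_mx 1%:M (- (Amx R *m g.2)^T) 0 (expA g.1)^T.
  by rewrite det_ublock det1 mul1r det_tr det_expA normr1.
apply/row_matrixP => i; rewrite !rowE /jacobian mul_rV_lin1.
by rewrite diff_val.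
Qed.

End Unimodular.

(** * A lattice of integral points in rescaled coordinates *)

Section Lattice.
Variable R : realType.

Let tau : R := pi *+ 2.

Lemma tau_gt0 : 0 < tau.
Proof. by rewrite mulrn_wgt0 // pi_gt0. Qed.

Lemma expA_tau (m : int) : expA (tau *~ m) = 1 + (tau *~ m) *: N8 R.
Proof.
have c : cos (tau *~ m) = 1.
  by rewrite -[tau *~ m]add0r (periodicz (@cosD2pi R)) cos0.
have s : sin (tau *~ m) = 0.
  by rewrite -[tau *~ m]add0r (periodicz (@sinD2pi R)) sin0.
by rewrite /expA c s mulr0 mulr1 !scale0r !addr0 scale1r Z3I8.
Qed.

Definition Dmx : 'M[R]_11 :=
  block_mx (1%:M : 'M[R]_3) 0 0
    (block_mx (1%:M : 'M[R]_4) 0 0 (tau%:M : 'M[R]_4)).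

Lemma Dmx_unit : Dmx \in unitmx.
Proof.
have E : \det Dmx = tau ^+ 4.
  rewrite -[LHS]/(\det (block_mx (1%:M : 'M[R]_3) 0 0
    (block_mx (1%:M : 'M[R]_4) 0 0 (tau%:M : 'M[R]_4)))).
  by rewrite !det_ublock !det1 !mul1r det_scalar.
by rewrite unitmxE E unitfE expf_neq0 // gt_eqF // tau_gt0.
Qed.

Lemma DmxE : Dmx = Z3 R + blk8 (block_mx 1%:M 0 0 tau%:M).
Proof.
have := add_block_mx (1%:M : 'M[R]_3) (0 : 'M[R]_(3, 4 + 4)) 0 0
    (0 : 'M[R]_3) 0 0 (block_mx (1%:M : 'M[R]_4) 0 0 (tau%:M : 'M[R]_4)).
by rewrite !addr0 !add0r.
Qed.

Lemma N8_Dmx : N8 R *m Dmx = N8 R.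
Proof.
rewrite DmxE mulmxDr /N8 -[X in X + _ = _]/(blk8 _ * Z3 R) blk8_Z3 add0r.
rewrite -[LHS]/(blk8 _ * blk8 _) blk8M; congr blk8.
by rewrite mulmx_block !(mul0mx, mulmx0, mulmx1, addr0).
Qed.

Lemma Dmx_N8 : Dmx *m N8 R = tau *: N8 R.
Proof.
have [_ _ _ ZN _] := Z3_mul R.
rewrite DmxE mulmxDl -[X in X + _ = _]/(Z3 R * N8 R) ZN add0r.
rewrite -[LHS]/(blk8 _ * blk8 _) blk8M.
rewrite mulmx_block !(mul0mx, mulmx0, mulmx1, addr0, add0r).
have := scale_block_mx tau (0 : 'M[R]_3) (0 : 'M[R]_(3, 4 + 4)) 0
  (block_mx (0 : 'M[R]_4) 0 (1%:M : 'M[R]_4) 0).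
by rewrite !scale_block_mx !scaler0 scale_scalar_mx mulr1 => /esym.
Qed.

(** [D] is the identity on the source of the shear [N] and [2 pi] on its target, so [N D = N] and
    [D N = 2 pi N]. Hence [e^{2 pi m A}] maps [D Z^11] into itself. *)
Lemma expA_Dmx (m : int) :
  expA (tau *~ m) *m Dmx = Dmx *m (1%:M + m%:~R *: N8 R).
Proof.
rewrite expA_tau mulmxDl mulmxDr mul1mx mulmx1 -scalemxAl -scalemxAr.
by rewrite N8_Dmx Dmx_N8 scalerA mulrzl.
Qed.

Lemma N8_int : N8 R \is a mxOver Num.int.
Proof.
apply/mxOverP => i j; rewrite /N8 /blk8 mxE.
case: splitP => i' _; rewrite mxE; case: splitP => j' _;
  rewrite ?mxE ?rpred0 //.
by case: splitP => i2 _; rewrite mxE; case: splitP => j2 _;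
  rewrite ?mxE ?rpred0.
Qed.

Definition S130_lattice : set (S130 R) :=
  [set x | exists m (z : 'cV[R]_11),
    z \is a mxOver Num.int /\ x = (tau *~ m, Dmx *m z)].

Lemma shear_int (m : int) (z : 'cV[R]_11) : z \is a mxOver Num.int ->
  (1%:M + m%:~R *: N8 R) *m z \is a mxOver Num.int.
Proof.
move=> zi; rewrite mulmxDl mul1mx; apply: (mxOverD zi).
rewrite mxOverM // mxOverZ ?N8_int //.
exact: intr_int.
Qed.

Lemma S130_lattice_group : group_closed [in S130_lattice].
Proof.
split.
  rewrite inE; exists 0, 0; split; first by rewrite mxOver0 ?rpred0.
  by rewrite mulmx0 mulr0z.
move=> x y; rewrite !inE => -[m [z [zi ->]]] [n [w [wi ->]]].
(* The second component of [x y^-1] is [D z - e^{2 pi (m-n) A} D w], from which [expA_Dmx] pulls out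
   [D]. *)
exists (m - n), (z - (1%:M + (m - n)%:~R *: N8 R) *m w); split.
  by apply: mxOverB => //; exact: shear_int.
rewrite -[LHS]/(S130_mul (tau *~ m, Dmx *m z) (S130_inv (tau *~ n, Dmx *m w))).
rewrite /S130_mul /S130_inv !expmx_AmxE /=.
have -> : expA (tau *~ m) *m - (expA (- (tau *~ n)) *m (Dmx *m w)) =
  - (Dmx *m (1%:M + (m - n)%:~R *: N8 R) *m w).
  rewrite mulmxN !mulmxA; congr (- (_ *m w)).
  rewrite -expA_Dmx; congr (_ *m Dmx).
  by rewrite -[LHS]/(expA _ * expA _) -expAD mulrzBr.
by congr (_, _); rewrite ?mulrzBr // mulmxBr mulmxA.
Qed.

(** An injective continuous chart sends lattice points to integral points. Distinct integers are at
    distance at least 1, so the preimage of a unit ball isolates each point. *)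
Lemma S130_lattice_discrete : S130_lattice `<=` isolated S130_lattice.
Proof.
move=> x Gx; split; first by rewrite inE.
pose chart (y : S130 R) : R * 'cV[R]_11 := (tau^-1 * y.1, invmx Dmx *m y.2).
have chart_int y : S130_lattice y ->
    (chart y).1 \is a Num.int /\ (chart y).2 \is a mxOver Num.int.
  case=> m [z [zi ->]]; rewrite /chart /= mulKmx ?Dmx_unit //; split => //.
  by rewrite -mulrzl mulrCA mulVf ?gt_eqF ?tau_gt0 // mulr1 intr_int.
have chart_inj : injective chart.
  move=> [t v] [s w] [/mulfI e1 /(congr1 (mulmx Dmx))].
  rewrite !mulKVmx ?Dmx_unit // => ->; congr (_, _); apply: e1.
  by rewrite invr_eq0 gt_eqF ?tau_gt0.
have chart_cont : chart y @[y --> x] --> chart x.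
  apply: (@cvg_S130 R (S130 R) (nbhs x)).
    by apply: cvgMl_tmp; exact: cvg_fst_at.
  by apply: mulmx_cvg; [exact: cvg_cst|exact: cvg_snd_at].
have int_ball (a b : R) :
    a \is a Num.int -> b \is a Num.int -> ball a 1 b -> a = b.
  move=> ai bi; rewrite -ball_normE /= => ab; apply/eqP; rewrite -subr_eq0.
  by apply: contraTT ab => /(norm_intr_ge1 (rpredB ai bi)); rewrite -leNgt.
exists (chart @^-1` (ball (chart x) 1)).
  by apply: chart_cont; exact: nbhsx_ballx.
apply/seteqP; split=> [y [yB Gy]|_ ->]; last by split=> //; exact: ballxx.
have [[x1 /mxOverP x2] [y1 /mxOverP y2]] := (chart_int _ Gx, chart_int _ Gy).
apply: chart_inj; case: yB => /(int_ball _ _ x1 y1) b1 [_ b2].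
apply/esym/pair_equal_spec; split=> //.
by apply/matrixP => i j; apply: int_ball.
Qed.

Lemma S130_lattice_cocompact : compact [set: right_coset_space S130_lattice].
Proof.
(* The box consists of row vectors, as in [rV_compact]; hence the transpose. *)
pose F (p : R * 'rV[R]_11) : S130 R := (p.1, Dmx *m p.2^T).
pose box : set (R * 'rV[R]_11) :=
  `[0, tau] `*` [set w : 'rV[R]_11 | forall i, `[0, 1]%classic (w ord0 i)].
have box_compact : compact box.
  apply: compact_setX; first exact: segment_compact.
  apply: (@rV_compact R 11 (fun=> `[0, 1]%classic)) => i.
  exact: segment_compact.
have F_cont : continuous F.
  move=> p; apply: cvg_S130; first exact: cvg_fst_at.
  apply: mulmx_cvg; first exact: cvg_cst.
  apply: mx_cvg => i j; rewrite mxE; under eq_fun do rewrite mxE.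
  exact: (cvg_comp _ _ (@cvg_snd_at _ _ p) (@coord_continuous _ _ _ j i p.2)).
pose q : S130 R -> right_coset_space S130_lattice :=
  \pi_(right_coset_space S130_lattice)%qT.
have q_cont : continuous q by exact: pi_continuous.
have -> : [set: right_coset_space S130_lattice] = (q \o F) @` box.
  apply/seteqP; split=> // X _; rewrite -[X]reprK.
  move: (repr X) => [t v].
  (* This [m] brings [t + 2 pi m] into [[0, 2 pi]]. The translation turns [v] into [e^{2 pi m A} v],
     whose coordinates in the basis [D] are [y]; then [z] removes their integer parts and [w] keeps
     the fractional ones. *)
  pose m := - Num.floor (tau^-1 * t).
  pose y := invmx Dmx *m (expA (tau *~ m) *m v).
  pose z : 'cV[R]_11 := \col_i (- Num.floor (y i 0))%:~R.
  pose w : 'rV[R]_11 := \row_i (y i 0 - (Num.floor (y i 0))%:~R).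
  exists (t + tau *~ m, w).
    split=> /=; last first.
      move=> i; rewrite /= in_itv /= mxE subr_ge0 floor_le lerBlDl /=.
      by rewrite -intrD1 ltW // floorD1_gt.
    have -> : t + tau *~ m = tau * (tau^-1 * t - (Num.floor (tau^-1 * t))%:~R).
      by rewrite mulrBr mulVKf ?gt_eqF ?tau_gt0 // mulrNz -mulrzr.
    rewrite in_itv /= mulr_ge0 ?(ltW tau_gt0) ?subr_ge0 ?floor_le //=.
    by rewrite ler_piMr ?(ltW tau_gt0) // lerBlDl -intrD1 ltW // floorD1_gt.
  pose c : S130 R := (tau *~ m, Dmx *m z).
  have cG : S130_lattice c.
    by exists m, z; split=> //; apply/mxOverP => i j; rewrite mxE intr_int.
  rewrite /=; have -> : F (t + tau *~ m, w) = (c * ((t, v) : S130 R))%g.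
    rewrite -[RHS]/(S130_mul c (t, v)) /S130_mul expmx_AmxE /F /=.
    congr (_, _); first by rewrite addrC.
    rewrite -[expA _ *m v](mulKVmx Dmx_unit) -mulmxDr; congr (_ *m _).
    by apply/matrixP => i j; rewrite !mxE (ord1 j) mulrNz addrC.
  apply/eqmodP/asboolP; exact: right_coset_mull S130_lattice_group cG.
apply: continuous_compact => //; apply: continuous_subspaceT => p.
by apply: continuous_comp; [exact: F_cont|exact: q_cont].
Qed.

End Lattice.

Theorem proposition6p11 (R : realType) :
  S130_unimodular R /\ exists Gam : set (S130 R), is_lattice Gam.
Proof.
split; first exact: S130_is_unimodular.
exists (@S130_lattice R); split.
- exact: S130_lattice_group.
- exact: S130_lattice_discrete.
- exact: S130_lattice_cocompact.
Qed.
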